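(* Let $\mathbf{A}\in\mathbb{R}^{m\times d}$ have full row rank, $\mathbf{b}\in\mathbb{R}^m$, $\mathbf{c}\in\mathbb{R}^d$, and let $\Omega:=\{x\in\mathbb{R}^d:\mathbf{A}x=\mathbf{b},\ x\geq0\}$. Assume that $\Omega$ is compact and that there exists $x_0\in\Omega$ with $x_0>0$ (componentwise). Then for every $\varepsilon>0$, the problem $$\mathbf{P}_\varepsilon:\quad\tau_\varepsilon=\min_{x}\{\,\mathbf{c}^Tx+\varepsilon f(x):\ \mathbf{A}x=\mathbf{b},\ x\geq0\,\}$$ has a unique optimal solution $x^*(\varepsilon)\in\Omega$, it satisfies $x^*(\varepsilon)>0$ (componentwise), and $$\tau_\varepsilon=\mathbf{c}^Tx^*(\varepsilon)+\varepsilon\sum_{i=1}^d x_i^*(\varepsilon)\ln(x_i^*(\varepsilon))=\max_{\lambda\in\mathbb{R}^m}G_\varepsilon(\lambda)=\mathbf{b}^T\lambda^*-\varepsilon\sum_{i=1}^d x_i^*(\varepsilon),$$ where the maximum of $G_\varepsilon$ over $\mathbb{R}^m$ is attained and $\lambda^*\in\mathbb{R}^m$ denotes a maximizer.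
   Context: $f(x):=\sum_{i=1}^d x_i\ln(x_i)$ if $x\geq0$ (with the convention $0\ln 0=0$) and $f(x):=+\infty$ otherwise. For $\varepsilon>0$ the dual function is $$G_\varepsilon(\lambda):=\inf_{x\in\mathbb{R}^d}\{\mathbf{c}^Tx+\lambda^T(\mathbf{b}-\mathbf{A}x)+\varepsilon f(x)\}=\mathbf{b}^T\lambda-\frac{\varepsilon}{e}\sum_{i=1}^d\exp\big((\mathbf{A}^T\lambda-\mathbf{c})_i/\varepsilon\big),\qquad\lambda\in\mathbb{R}^m.$$ *)

(* Defs.v *)
From HB Require Import structures.
From mathcomp Require Import all_boot all_order all_algebra.
From mathcomp Require Import all_classical all_reals all_analysis.
Import Order.TTheory GRing.Theory Num.Theory.
Import numFieldNormedType.Exports.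

Set Implicit Arguments.
Unset Strict Implicit.
Unset Printing Implicit Defensive.

Local Open Scope classical_set_scope.
Local Open Scope ring_scope.

Definition dotv (R : realType) (n : nat) (u v : 'cV[R]_n) : R :=
  (u^T *m v) 0 0.

Definition feasible (R : realType) (m d : nat) (A : 'M[R]_(m, d))
    (b : 'cV[R]_m) : set 'cV[R]_d :=
  [set x | A *m x = b /\ forall i, 0 <= x i 0].

(* The convention 0 ln 0 = 0 holds automatically, since [ln] is total. *)
Definition xlnx_sum (R : realType) (d : nat) (x : 'cV[R]_d) : R :=
  \sum_(i < d) x i 0 * ln (x i 0).

Definition entropy (R : realType) (d : nat) (x : 'cV[R]_d) : \bar R :=
  if [forall i, 0 <= x i 0] then (xlnx_sum x)%:E else +oo%E.

Definition primal_obj (R : realType) (d : nat) (c : 'cV[R]_d) (eps : R)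
    (x : 'cV[R]_d) : \bar R :=
  ((dotv c x)%:E + eps%:E * entropy x)%E.

Definition primal_value (R : realType) (m d : nat) (A : 'M[R]_(m, d))
    (b : 'cV[R]_m) (c : 'cV[R]_d) (eps : R) : \bar R :=
  ereal_inf (primal_obj c eps @` feasible A b).

Definition is_minimizer (R : realType) (T : Type) (S : set T)
    (F : T -> \bar R) (x : T) : Prop :=
  S x /\ forall y, S y -> (F x <= F y)%E.

Definition is_maximizer (R : realType) (T : Type) (S : set T)
    (F : T -> \bar R) (x : T) : Prop :=
  S x /\ forall y, S y -> (F y <= F x)%E.

(* The infimum ranges over all of R^d; the constraint x >= 0 is enforced by
   [entropy x = +oo] outside the nonnegative orthant. *)
Definition dual_fun (R : realType) (m d : nat) (A : 'M[R]_(m, d))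
    (b : 'cV[R]_m) (c : 'cV[R]_d) (eps : R) (lam : 'cV[R]_m) : \bar R :=
  ereal_inf (range (fun x : 'cV[R]_d =>
    ((dotv c x)%:E + (dotv lam (b - A *m x))%:E + eps%:E * entropy x)%E)).

(* Main.v *)
(* Continuity and compactness give a primal minimizer x*.  It is positive,
   because t ln t has slope -oo at 0 and a Slater point is available, so the
   gradient g of the objective at x* annihilates ker A, that is,
   g = A^T lambda for some lambda.  By convexity x* then minimizes the
   Lagrangian at lambda, which closes the duality gap; strict convexity gives
   uniqueness.  Conversely, at any dual maximizer the Lagrangian is stationary
   at x*, and its derivative in the direction x* yields the value formula.
   Derivatives are replaced throughout by the bounds
   y ln x + y - x <= y ln y <= y ln x + y (y - x) / x. *)
Require Import Defs.
From HB Require Import structures.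
From mathcomp Require Import all_boot all_order all_algebra.
From mathcomp Require Import all_classical all_reals all_analysis.
From mathcomp Require Import ring lra.
Import Order.TTheory GRing.Theory Num.Theory.
Import numFieldNormedType.Exports.

Local Open Scope classical_set_scope.
Local Open Scope ring_scope.

Section Entropic.
Set Implicit Arguments.
Unset Strict Implicit.

(** Real-valued form of the objective. The linear part [q] is left free so that the Lagrangian at
    [lam] is, up to a constant, the case [q = c - A^T *m lam]. *)
Definition entropic (R : realType) (d : nat) (q : 'cV[R]_d) (eps : R)
    (x : 'cV[R]_d) : R := dotv q x + eps * xlnx_sum x.

Definition entropic_grad (R : realType) (d : nat) (q : 'cV[R]_d) (eps : R)
    (x : 'cV[R]_d) : 'cV[R]_d := \col_i (q i 0 + eps * (ln (x i 0) + 1)).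

(** * Tangent, quadratic and chord bounds for [t ln t], and its continuity *)

Section XlnX.
Context {R : realType}.
Implicit Types x y h s : R.

Lemma ln_leB1 x : 0 < x -> ln x <= x - 1.
Proof.
move=> x0; have := @le_ln1Dx R (x - 1).
by rewrite (_ : 1 + (x - 1) = x); [apply; lra | ring].
Qed.

Lemma ln_ltB1 x : 0 < x -> x != 1 -> ln x < x - 1.
Proof.
move=> x0 x1; have lnx0 : ln x != 0 by rewrite ln_eq0.
by have := expR_gt1Dx lnx0; rewrite lnK ?posrE//; lra.
Qed.

(** This is [ln u <= u - 1] at [u = x / y], multiplied by [y]; [y = 0] is treated apart. *)
Lemma xlnx_ge_tangent x y : 0 < x -> 0 <= y ->
  x * ln x + (y - x) * (ln x + 1) <= y * ln y.
Proof.
move=> x0; rewrite le_eqVlt => /predU1P[<-|y0]; first by rewrite mul0r; lra.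
have := ln_leB1 (divr_gt0 x0 y0).
rewrite ln_div ?posrE// -(ler_pM2l y0).
have -> : y * (x / y - 1) = x - y by field; lra.
lra.
Qed.

Lemma xlnx_gt_tangent x y : 0 < x -> 0 <= y -> y != x ->
  x * ln x + (y - x) * (ln x + 1) < y * ln y.
Proof.
move=> x0; rewrite le_eqVlt => /predU1P[<-|y0] yx; first by rewrite mul0r; lra.
have xy1 : x / y != 1.
  apply: contra_neq yx => /(congr1 ( *%R^~ y)).
  by rewrite mul1r mulfVK// gt_eqF.
have := ln_ltB1 (divr_gt0 x0 y0) xy1.
rewrite ln_div ?posrE// -(ltr_pM2l y0).
have -> : y * (x / y - 1) = x - y by field; lra.
lra.
Qed.

(** With [y = x + s * h] the right side equals [y * (ln x + (y / x - 1))], and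
    [ln (y / x) <= y / x - 1]. *)
Lemma xlnx_le_quadratic x h s : 0 < x -> 0 <= x + s * h ->
  (x + s * h) * ln (x + s * h) <=
  x * ln x + s * (h * (ln x + 1)) + s ^+ 2 * (h ^+ 2 / x).
Proof.
move=> x0 y0; set y := x + s * h in y0 *.
have -> : x * ln x + s * (h * (ln x + 1)) + s ^+ 2 * (h ^+ 2 / x) =
          y * (ln x + (y / x - 1)) by rewrite /y; field; lra.
move: y0; rewrite le_eqVlt => /predU1P[<-|y0]; first by rewrite !mul0r.
rewrite ler_pM2l//; have := ln_leB1 (divr_gt0 y0 x0).
by rewrite ln_div ?posrE//; lra.
Qed.

Lemma xlnxM x t : 0 < t -> 0 < x ->
  (t * x) * ln (t * x) = t * (x * ln x) + t * x * ln t.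
Proof. by move=> t0 x0; rewrite lnM ?posrE//; ring. Qed.

(** Average the tangent bounds at the intermediate point [z] with weights [t] and [1 - t]: the slope
    terms cancel. Here [z > 0] because [y > 0], even when [x = 0]. *)
Lemma xlnx_convex x y t : 0 <= x -> 0 < y -> 0 < t <= 1 ->
  (x + t * (y - x)) * ln (x + t * (y - x)) <=
  x * ln x + t * (y * ln y - x * ln x).
Proof.
move=> x0 y0 /andP[t0 t1]; set z := x + t * (y - x).
have z0 : 0 < z by rewrite /z; nra.
have := xlnx_ge_tangent z0 x0; have := xlnx_ge_tangent z0 (ltW y0).
rewrite -(ler_pM2l t0) => hy.
have : 0 <= 1 - t by lra.
move=> /ler_wpM2l /[apply] hx.
have := lerD hy hx.
have -> : t * (z * ln z + (y - z) * (ln z + 1)) +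
    (1 - t) * (z * ln z + (x - z) * (ln z + 1)) = z * ln z by rewrite /z; ring.
lra.
Qed.

(** For positive [x] and [u = sqrt x], [- x ln x = 2 u^2 ln (1 / u) <= 2 u (1 - u)]. *)
Lemma abs_xlnx_le_sqrt x : x <= 1 -> `|x * ln x| <= 2 * Num.sqrt x.
Proof.
move=> x1; have [x0|x0] := leP x 0.
  by rewrite ln0// mulr0 normr0 mulr_ge0.
set u := Num.sqrt x.
have u0 : 0 < u by rewrite sqrtr_gt0.
have xE : x = u ^+ 2 by rewrite sqr_sqrtr ?ltW.
have lnxE : ln x = 2 * ln u by rewrite xE lnXn// mulr_natl.
have lnx0 : x * ln x <= 0 by rewrite mulr_ge0_le0 ?ln_le0// ltW.
have uV0 : 0 < u^-1 by rewrite invr_gt0.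
rewrite ler0_norm// lnxE xE.
have := ln_leB1 uV0; rewrite lnV ?posrE// -(ler_pM2l u0) mulrBr mulfV ?gt_eqF//.
move=> /(ler_wpM2l (ltW u0)); have := sqr_ge0 u; lra.
Qed.

(** Holds on the whole line since [ln] is 0 on nonpositive reals; only the origin needs the
    square-root bound. *)
Lemma continuous_xlnx : continuous (fun x : R => x * ln x).
Proof.
move=> x; have [x0|x0|->] := ltgtP x 0.
- rewrite /continuous_at ln0 ?ltW// mulr0; apply: cvg_near_cst.
  by near=> y; rewrite ln0 ?mulr0// ltW//; near: y; exact: lt_nbhsl.
- by apply: continuousM; [exact: cvg_id|exact: continuous_ln].
rewrite /continuous_at mul0r; apply/cvgr0Pnorm_le => e e0.
near=> y; apply: (le_trans (abs_xlnx_le_sqrt _)).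
  by apply: ltW; near: y; exact: lt_nbhsl.
have -> : e = 2 * Num.sqrt ((e / 2) ^+ 2).
  by rewrite sqrtr_sqr ger0_norm ?divr_ge0 ?ltW//; field.
rewrite ler_pM2l// ler_wsqrtr// ltW//; near: y; apply: lt_nbhsl.
by rewrite exprn_gt0// divr_gt0.
Unshelve. all: by end_near. Qed.

End XlnX.

Lemma continuous_sum (T : topologicalType) (R : realType) (I : Type)
    (r : seq I) (f : I -> T -> R) :
  (forall i, continuous (f i)) -> continuous (fun x => \sum_(i <- r) f i x).
Proof.
move=> cf; elim: r => [|i r IH] x.
  by under eq_fun do rewrite big_nil; exact: cvg_cst.
under eq_fun do rewrite big_cons.
by apply: continuousD; [exact: cf|exact: IH].
Qed.

(** * First-order bounds and minimizers of the entropic functional *)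

Section Entropic_functional.
Context {R : realType} {d : nat}.
Implicit Types (q x y h : 'cV[R]_d) (eps : R).

Lemma dotvE n (u v : 'cV[R]_n) : dotv u v = \sum_i u i 0 * v i 0.
Proof. by rewrite /dotv mxE; apply: eq_bigr => i _; rewrite mxE. Qed.

Lemma entropicE q eps x :
  entropic q eps x = \sum_i (q i 0 * x i 0 + eps * (x i 0 * ln (x i 0))).
Proof. by rewrite /entropic dotvE /xlnx_sum mulr_sumr big_split. Qed.

Lemma continuous_entropic q eps : continuous (entropic q eps).
Proof.
have /funext -> := entropicE q eps.
apply: continuous_sum => i x.
have ci : {for x, continuous (fun y : 'cV[R]_d => y i 0)}.
  exact: coord_continuous.
have cx : {for x, continuous (fun y : 'cV[R]_d => y i 0 * ln (y i 0))}.
  exact: (continuous_comp ci (@continuous_xlnx R (x i 0))).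
apply: (@continuousD R R _ (fun y : 'cV[R]_d => q i 0 * y i 0)
  (fun y : 'cV[R]_d => eps * (y i 0 * ln (y i 0)))).
  by apply: (@continuousM R _ (cst (q i 0))); [exact: cst_continuous|exact: ci].
by apply: (@continuousM R _ (cst eps)); [exact: cst_continuous|exact: cx].
Qed.

Lemma entropic_ge_tangent q eps x y : 0 <= eps ->
  (forall i, 0 < x i 0) -> (forall i, 0 <= y i 0) ->
  entropic q eps x + dotv (entropic_grad q eps x) (y - x) <= entropic q eps y.
Proof.
move=> eps0 x0 y0; rewrite !entropicE dotvE -big_split; apply: ler_sum => i _.
rewrite !mxE /=; have := ler_wpM2l eps0 (xlnx_ge_tangent (x0 i) (y0 i)); lra.
Qed.

Lemma entropic_gt_tangent q eps x y : 0 < eps ->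
  (forall i, 0 < x i 0) -> (forall i, 0 <= y i 0) -> y != x ->
  entropic q eps x + dotv (entropic_grad q eps x) (y - x) < entropic q eps y.
Proof.
move=> eps0 x0 y0 yx.
have [i yxi] : exists i, y i 0 != x i 0.
  apply/existsP; apply: contraNT yx => /existsPn yx; apply/eqP/colP => i.
  exact/eqP/negPn/yx.
rewrite !entropicE dotvE -big_split /= (bigD1 i)//= [ltRHS](bigD1 i)//=.
apply: ltr_leD.
  have tan := xlnx_gt_tangent (x0 i) (y0 i) yxi.
  rewrite -(ltr_pM2l eps0) in tan; rewrite !mxE; lra.
apply: ler_sum => j _; rewrite !mxE.
have := ler_wpM2l (ltW eps0) (xlnx_ge_tangent (x0 j) (y0 j)); lra.
Qed.

Lemma entropic_le_quadratic q eps x h s : 0 <= eps ->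
  (forall i, 0 < x i 0) -> (forall i, 0 <= (x + s *: h) i 0) ->
  entropic q eps (x + s *: h) <= entropic q eps x +
    s * dotv (entropic_grad q eps x) h +
    s ^+ 2 * (eps * \sum_i h i 0 ^+ 2 / x i 0).
Proof.
move=> eps0 x0 xh0; rewrite !entropicE dotvE !mulr_sumr -!big_split /=.
apply: ler_sum => i _; have := xh0 i; rewrite !mxE => xhi.
have := ler_wpM2l eps0 (xlnx_le_quadratic (x0 i) xhi); lra.
Qed.

(** A negative slope [D] would give [s * D + s ^+ 2 * C < 0] for some small [s > 0], contradicting
    minimality. *)
Lemma entropic_grad_ge0 q eps x h : 0 <= eps -> (forall i, 0 < x i 0) ->
  (forall s, (forall i, 0 <= (x + s *: h) i 0) ->
    entropic q eps x <= entropic q eps (x + s *: h)) ->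
  0 <= dotv (entropic_grad q eps x) h.
Proof.
move=> eps0 x0 xmin; rewrite leNgt; apply/negP => D0.
set D := dotv _ _ in D0; set C := eps * \sum_i h i 0 ^+ 2 / x i 0.
pose N := \sum_i `|h i 0| / x i 0.
have N0 : 0 <= N by apply: sumr_ge0 => i _; rewrite divr_ge0// ltW.
have C0 : 0 <= C.
  by rewrite mulr_ge0// sumr_ge0// => i _; rewrite divr_ge0 ?sqr_ge0// ltW.
(* Since [|h i 0| <= N * x i 0], the bound [s * N <= 1] keeps [x + s *: h] in the orthant, while
   [s * C < - D] lets the linear term win. The witness works because [K] exceeds both [N * - D] and
   [C]. *)
have [s [s0 sN sC]] : exists s, [/\ 0 < s, s * N <= 1 & s * C < - D].
  pose K := (1 + N) * - D + C + 1.
  have K0 : 0 < K by rewrite /K; nra.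
  exists (- D / K); split; first by rewrite divr_gt0// oppr_gt0.
    by rewrite mulrAC ler_pdivrMr// /K; nra.
  by rewrite mulrAC ltr_pdivrMr// /K; nra.
have xh0 i : 0 <= (x + s *: h) i 0.
  have hN : `|h i 0| <= N * x i 0.
    rewrite -ler_pdivrMr// /N (bigD1 i)//= lerDl.
    by apply: sumr_ge0 => j _; rewrite divr_ge0// ltW.
  have := ler_wpM2l (ltW s0) hN; have := ler_wpM2r (ltW (x0 i)) sN.
  have := ler_wpM2l (ltW s0) (ler_norm (- h i 0)); rewrite normrN !mxE; lra.
have := le_trans (xmin _ xh0) (entropic_le_quadratic q eps0 x0 xh0).
rewrite -/D -/C -addrA lerDl expr2 -mulrA -mulrDr pmulr_rge0//; lra.
Qed.

(* The slope of [t ln t] at 0 is -oo: a vanishing coordinate would make the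
   objective decrease on moving towards [y]. *)
Lemma entropic_min_gt0 q eps x y : 0 < eps ->
  (forall i, 0 <= x i 0) -> (forall i, 0 < y i 0) ->
  (forall t, 0 < t <= 1 ->
    entropic q eps x <= entropic q eps (x + t *: (y - x))) ->
  forall i, 0 < x i 0.
Proof.
move=> eps0 x0 y0 xmin i; rewrite lt0r x0 andbT; apply/eqP => xi0.
pose E := entropic q eps y - entropic q eps x.
(* The vanishing coordinate [i] supplies the [ln t] term exactly, the others lie below their chords,
   and everything is divided by [t]. *)
have key t : 0 < t <= 1 -> 0 <= E + eps * y i 0 * ln t.
  move=> /[dup] t01 /andP[t0 t1]; rewrite -(pmulr_rge0 _ t0).
  have := xmin t t01; rewrite -subr_ge0 => /le_trans; apply.
  rewrite mulrDr /E !entropicE -!sumrB mulr_sumr.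
  rewrite (bigD1 i)//= [in leRHS](bigD1 i)//= [leRHS]addrAC; apply: lerD.
    by rewrite !mxE xi0 !(subr0, add0r) xlnxM//; lra.
  apply: ler_sum => j _; rewrite !mxE.
  have := ler_wpM2l (ltW eps0) (xlnx_convex (x0 j) (y0 j) t01); lra.
have ey0 : 0 < eps * y i 0 by rewrite mulr_gt0.
(* This [t] solves [eps * y i 0 * ln t = - |E| - 1], so [key] would give [0 <= E - |E| - 1]. *)
have := key (expR (- (`|E| + 1) / (eps * y i 0))).
rewrite expR_gt0 expRK mulrCA mulfV ?gt_eqF// mulr1.
have : expR (- (`|E| + 1) / (eps * y i 0)) <= 1.
  by rewrite -expR0 ler_expR pmulr_lle0 ?invr_gt0// oppr_le0 addr_ge0.
by move=> -> /(_ isT); have := ler_norm E; lra.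
Qed.

(** * Inner products, multipliers and gradient identities *)

Lemma dotvC n (u v : 'cV[R]_n) : dotv u v = dotv v u.
Proof. by rewrite !dotvE; apply: eq_bigr => i _; rewrite mulrC. Qed.

Lemma dotvBr n (u v w : 'cV[R]_n) : dotv u (v - w) = dotv u v - dotv u w.
Proof. by rewrite /dotv mulmxBr !mxE. Qed.

Lemma dotvNr n (u v : 'cV[R]_n) : dotv u (- v) = - dotv u v.
Proof. by rewrite /dotv mulmxN !mxE. Qed.

Lemma dotv_trmx m n (M : 'M[R]_(m, n)) u v :
  dotv (M^T *m u) v = dotv u (M *m v).
Proof. by rewrite /dotv trmx_mul trmxK mulmxA. Qed.

(** The columns of [cokermx M] lie in the kernel of [M], so [g^T] kills them and hence lies in the
    row space of [M]. This produces the Lagrange multiplier. *)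
Lemma orthogonal_ker_trmx m n (M : 'M[R]_(m, n)) (g : 'cV[R]_n) :
  (forall h : 'cV[R]_n, M *m h = 0 -> dotv g h = 0) -> exists u, g = M^T *m u.
Proof.
move=> gM; have /submxP[u gE] : (g^T <= M)%MS.
  rewrite submxE; apply/eqP/rowP => j; rewrite [RHS]mxE.
  have := gM (col j (cokermx M)).
  rewrite /dotv colE (mulmxA M) mulmx_coker mul0mx => /(_ erefl).
  by rewrite (mulmxA g^T) -colE mxE.
by exists u^T; rewrite -trmx_mul -gE trmxK.
Qed.

Lemma entropicB q u eps x :
  entropic (q - u) eps x = entropic q eps x - dotv u x.
Proof. by rewrite /entropic !(dotvC _ x) dotvBr; ring. Qed.

Lemma entropic_gradB q u eps x :
  entropic_grad (q - u) eps x = entropic_grad q eps x - u.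
Proof. by apply/colP => i; rewrite !mxE; ring. Qed.

(** The entropy is not homogeneous; the excess [eps * \sum_i x i 0] is the term that appears in the
    value formula. *)
Lemma entropic_grad_self q eps x :
  dotv (entropic_grad q eps x) x = entropic q eps x + eps * \sum_i x i 0.
Proof.
rewrite dotvE entropicE mulr_sumr -big_split /=.
by apply: eq_bigr => i _; rewrite mxE; ring.
Qed.

Lemma entropy_ge0E x : (forall i, 0 <= x i 0) -> entropy x = (xlnx_sum x)%:E.
Proof. by rewrite /entropy => /forallP ->. Qed.

Lemma primal_objE q eps x : (forall i, 0 <= x i 0) ->
  primal_obj q eps x = (entropic q eps x)%:E.
Proof. by move=> x0; rewrite /primal_obj entropy_ge0E. Qed.

(** * Weak duality, strong duality and uniqueness *)

Section duality.
Context {m : nat} (A : 'M[R]_(m, d)) (b : 'cV[R]_m) (c : 'cV[R]_d) (eps : R).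
Hypothesis eps_gt0 : 0 < eps.

(** The Lagrangian is [+oo] off the orthant, so lower bounds of the dual become real inequalities,
    even before its value is known to be finite. *)
Lemma dual_fun_geP lam (r : R) :
  (r%:E <= dual_fun A b c eps lam)%E <->
  (forall x, (forall i, 0 <= x i 0) ->
    r <= dotv b lam + entropic (c - A^T *m lam) eps x).
Proof.
have lagE x : (forall i, 0 <= x i 0) ->
    ((dotv c x)%:E + (dotv lam (b - A *m x))%:E + eps%:E * entropy x)%E =
    (dotv b lam + entropic (c - A^T *m lam) eps x)%:E.
  move=> x0; rewrite entropy_ge0E// -EFinM -!EFinD; congr _%:E.
  by rewrite dotvBr entropicB dotv_trmx (dotvC b) /entropic; ring.
split=> [rG x x0|rL].
  rewrite -lee_fin -lagE//; apply: (le_trans rG).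
  by apply: ereal_inf_lbound; exists x.
apply: le_ereal_inf_tmp => _ [x _ <-].
have [/forallP x0|xN] := boolP [forall i, 0 <= x i 0].
  by rewrite lagE// lee_fin; exact: rL.
by rewrite /entropy (negbTE xN) gt0_muley ?lte_fin// addey ?leey.
Qed.

Lemma dual_fun_le lam x : (forall i, 0 <= x i 0) ->
  (dual_fun A b c eps lam <=
    (dotv b lam + entropic (c - A^T *m lam) eps x)%:E)%E.
Proof.
move=> x0; case E: (dual_fun A b c eps lam) => [r| |]//; last exact: leNye.
  have : (r%:E <= dual_fun A b c eps lam)%E by rewrite E.
  by move=> /dual_fun_geP /(_ x x0); rewrite lee_fin.
(* If the infimum were [+oo], even a real exceeding the value at [x] would be a lower bound. *)
pose r := dotv b lam + entropic (c - A^T *m lam) eps x + 1.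
have : (r%:E <= dual_fun A b c eps lam)%E by rewrite E leey.
by move=> /dual_fun_geP /(_ x x0); rewrite /r gerDl ler10.
Qed.

Lemma lagrangian_feasible lam x : A *m x = b ->
  dotv b lam + entropic (c - A^T *m lam) eps x = entropic c eps x.
Proof. by move=> Ax; rewrite entropicB dotv_trmx Ax dotvC; ring. Qed.

Lemma weak_duality lam x : feasible A b x ->
  (dual_fun A b c eps lam <= (entropic c eps x)%:E)%E.
Proof.
by move=> [Ax x0]; rewrite -(lagrangian_feasible lam Ax) dual_fun_le.
Qed.

Lemma primal_valueE xs : feasible A b xs ->
  (forall y, feasible A b y -> entropic c eps xs <= entropic c eps y) ->
  primal_value A b c eps = (entropic c eps xs)%:E.
Proof.
move=> xsF xsmin; apply/eqP; rewrite eq_le; apply/andP; split.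
  by apply: ereal_inf_lbound; exists xs => //; rewrite primal_objE//; case: xsF.
apply: le_ereal_inf_tmp => _ [y yF <-]; rewrite primal_objE; last by case: yF.
by rewrite lee_fin xsmin.
Qed.

Lemma entropic_min_exists : compact (feasible A b) -> feasible A b !=set0 ->
  exists2 xs, feasible A b xs &
    forall y, feasible A b y -> entropic c eps xs <= entropic c eps y.
Proof.
move=> cF F0.
have [xs /set_mem xsF xsmin] := compact_EVT_min F0 cF
  (continuous_subspaceT (@continuous_entropic c eps)).
by exists xs => // y yF; apply: xsmin; exact: mem_set.
Qed.

Lemma min_feasible_gt0 xs x0 : feasible A b xs ->
  (forall y, feasible A b y -> entropic c eps xs <= entropic c eps y) ->
  feasible A b x0 -> (forall i, 0 < x0 i 0) -> forall i, 0 < xs i 0.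
Proof.
move=> [Axs xs0] xsmin [Ax0 _] x0_gt0.
apply: (entropic_min_gt0 eps_gt0 xs0 x0_gt0) => t /andP[t0 t1].
apply: xsmin; split.
  by rewrite mulmxDr -scalemxAr mulmxBr Axs Ax0 subrr scaler0 addr0.
by move=> i; rewrite !mxE; have := xs0 i; have := x0_gt0 i; nra.
Qed.

Section positive_minimizer.
Variable xs : 'cV[R]_d.
Hypothesis xsF : feasible A b xs.
Hypothesis xsmin :
  forall y, feasible A b y -> entropic c eps xs <= entropic c eps y.
Hypothesis xs_gt0 : forall i, 0 < xs i 0.

Let g := entropic_grad c eps xs.

(** As [xs] is positive, small moves along both [h] and [- h] stay feasible, so the slope is
    nonnegative both ways. *)
Lemma min_grad_orthogonal h : A *m h = 0 -> dotv g h = 0.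
Proof.
have ge0 k : A *m k = 0 -> 0 <= dotv g k.
  move=> Ak; apply: entropic_grad_ge0 => // [|s xsk]; first exact: ltW.
  apply: xsmin; split=> //.
  by rewrite mulmxDr -scalemxAr Ak scaler0 addr0; case: xsF.
move=> Ah; apply/eqP; rewrite eq_le ge0// andbT -oppr_ge0 -dotvNr.
by rewrite ge0// mulmxN Ah oppr0.
Qed.

(** [y - xs] lies in the kernel of [A], so the gradient term vanishes and the strict tangent bound
    would put [y] strictly above [xs]. *)
Lemma min_unique y : feasible A b y ->
  entropic c eps y <= entropic c eps xs -> xs = y.
Proof.
move=> [Ay y0] yxs; apply/eqP; rewrite eq_sym; apply/negPn/negP => yNxs.
have := entropic_gt_tangent c eps_gt0 xs_gt0 y0 yNxs.
rewrite min_grad_orthogonal ?addr0 ?ltNge ?yxs//.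
by rewrite mulmxBr Ay; case: xsF => ->; rewrite subrr.
Qed.

(** With [g = A^T *m ls] the gradient of the Lagrangian vanishes at [xs], so by the tangent bound
    [xs] minimizes it over the orthant. *)
Lemma dual_attained :
  exists ls, dual_fun A b c eps ls = (entropic c eps xs)%:E.
Proof.
have [ls gE] := orthogonal_ker_trmx min_grad_orthogonal.
exists ls; apply/eqP; rewrite eq_le weak_duality//=; apply/dual_fun_geP => x x0.
rewrite -(lagrangian_feasible ls (proj1 xsF)) lerD2l.
have := entropic_ge_tangent (c - A^T *m ls) (ltW eps_gt0) xs_gt0 x0.
by rewrite entropic_gradB -/g gE subrr /dotv trmx0 mul0mx mxE addr0.
Qed.

(* At a dual optimum [xs] minimizes the Lagrangian over the orthant, hence the
   Lagrangian is stationary along the ray through [xs]. *)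
Lemma dual_optimal_value ls : dual_fun A b c eps ls = (entropic c eps xs)%:E ->
  entropic c eps xs = dotv b ls - eps * \sum_i xs i 0.
Proof.
move=> lsE.
have xslag y : (forall i, 0 <= y i 0) ->
    entropic (c - A^T *m ls) eps xs <= entropic (c - A^T *m ls) eps y.
  move=> y0; rewrite -(lerD2l (dotv b ls)) (lagrangian_feasible _ (proj1 xsF)).
  by move: y y0; apply/dual_fun_geP; rewrite lsE.
have ge0 h : 0 <= dotv (entropic_grad (c - A^T *m ls) eps xs) h.
  by apply: entropic_grad_ge0 => // [|s xsh]; [exact: ltW|exact: xslag].
(* The slopes along [xs] and [- xs] are both nonnegative, so the entropic part of the Lagrangian at
   [xs] equals [- eps * \sum_i xs i 0]. *)
have := ge0 xs; have := ge0 (- xs); rewrite dotvNr entropic_grad_self.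
by rewrite -(lagrangian_feasible ls (proj1 xsF)); lra.
Qed.

End positive_minimizer.
End duality.
End Entropic_functional.
End Entropic.

Theorem corollary2p3 (R : realType) (m d : nat) (A : 'M[R]_(m, d))
    (b : 'cV[R]_m) (c : 'cV[R]_d)
    (rankA : row_free A)
    (compact_Omega : compact (feasible A b))
    (slater : exists2 x0 : 'cV[R]_d,
       feasible A b x0 & forall i, 0 < x0 i 0)
    (eps : R) (eps_gt0 : 0 < eps) :
  exists xs : 'cV[R]_d,
    [/\ unique (is_minimizer (feasible A b) (primal_obj c eps)) xs,
        forall i, 0 < xs i 0,
        primal_value A b c eps = (dotv c xs + eps * xlnx_sum xs)%:E,
        primal_value A b c eps = ereal_sup (range (dual_fun A b c eps)) &
        (exists ls, is_maximizer setT (dual_fun A b c eps) ls) /\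
        (forall ls, is_maximizer setT (dual_fun A b c eps) ls ->
           primal_value A b c eps =
             (dotv b ls - eps * \sum_(i < d) xs i 0)%:E)].
Proof.
have [x0 x0F x0_gt0] := slater.
have [xs xsF xsmin] :=
  entropic_min_exists c eps compact_Omega (ex_intro _ x0 x0F).
have xs_gt0 := min_feasible_gt0 eps_gt0 xsF xsmin x0F x0_gt0.
have valE := primal_valueE xsF xsmin.
have [ls lsE] := dual_attained eps_gt0 xsF xsmin xs_gt0.
have lsmax : is_maximizer setT (dual_fun A b c eps) ls.
  by split=> // y _; rewrite lsE weak_duality.
exists xs; split=> //.
- split=> [|y [yF ymin]].
    split=> // y yF; rewrite !primal_objE ?lee_fin ?xsmin//; first by case: yF.
    by case: xsF.
  apply: (min_unique eps_gt0 xsF xsmin xs_gt0 yF).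
  move: (ymin xs xsF); rewrite !primal_objE ?lee_fin//; first by case: xsF.
  by case: yF.
- rewrite valE; apply/eqP; rewrite eq_le; apply/andP; split.
    by apply: ereal_sup_ubound; exists ls.
  by apply: ge_ereal_sup => _ [y _ <-]; rewrite weak_duality.
- split; first by exists ls.
  move=> l [_ lmax]; rewrite valE; congr _%:E.
  apply: (dual_optimal_value eps_gt0 xsF xs_gt0).
  (* A maximizer [l] does at least as well as [ls], and weak duality caps it, so its dual value is
     the primal one. *)
  by apply/eqP; rewrite eq_le weak_duality//= -lsE lmax.
Qed.
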